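(* Let $G$ be a Polish group. Then there exists a continuously universal Polish $G$-space: there is a Polish space $X$ with a continuous action of $G$ such that for every Polish space $Y$ with a continuous action of $G$ there is a map $\pi:Y\to X$ which is continuous, one-to-one, and satisfies $\pi(g\cdot y)=g\cdot\pi(y)$ for all $g\in G$, $y\in Y$.
   Context: A Polish space is a separable topological space admitting a compatible complete metric; a Polish group is a topological group whose underlying space is Polish. A Polish $G$-space is a Polish space on which the Polish group $G$ acts continuously (i.e. the map $G\times X\to X$ is jointly continuous). *)

(* Defs.v *)
From HB Require Import structures.
From mathcomp Require Import all_boot all_order all_algebra.
From mathcomp Require Import all_classical all_reals all_analysis.
From mathcomp Require Import Rstruct Rstruct_topology.

Set Implicit Arguments.
Unset Strict Implicit.
Unset Printing Implicit Defensive.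

Import Order.TTheory GRing.Theory Num.Theory.
Local Open Scope classical_set_scope.
Local Open Scope ring_scope.

Definition compatible_complete_metric (T : topologicalType)
    (d : T -> T -> Rdefinitions.R) : Prop :=
  [/\ (forall x y, (0 <= d x y) /\ (d x y = 0 <-> x = y)),
      (forall x y, d x y = d y x),
      (forall x y z, (d x z <= d x y + d y z)),
      (forall A : set T, open A <->
         (forall x, A x -> exists e : Rdefinitions.R, (0 < e) /\
             forall y, (d x y < e) -> A y)) &
      (forall u : nat -> T,
         (forall e : Rdefinitions.R, (0 < e) -> exists N : nat,
             forall m n : nat, (leq N m) -> (leq N n) -> (d (u m) (u n) < e)) ->
         exists l : T, forall e : Rdefinitions.R, (0 < e) -> exists N : nat,
             forall n : nat, (leq N n) -> (d (u n) l < e))].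

Definition polish (T : topologicalType) : Prop :=
  (exists D : set T, countable D /\ dense D) /\
  (exists d : T -> T -> Rdefinitions.R, compatible_complete_metric d).

Definition topological_group (G : topologicalType)
    (mul : G -> G -> G) (one : G) (inv : G -> G) : Prop :=
  [/\ (forall x y z, mul x (mul y z) = mul (mul x y) z),
      (forall x, mul one x = x /\ mul x one = x),
      (forall x, mul (inv x) x = one /\ mul x (inv x) = one),
      continuous (fun p : G * G => mul p.1 p.2) &
      continuous inv].

Definition polish_group (G : topologicalType)
    (mul : G -> G -> G) (one : G) (inv : G -> G) : Prop :=
  topological_group mul one inv /\ polish G.

Definition continuous_action (G X : topologicalType)
    (mul : G -> G -> G) (one : G) (act : G -> X -> X) : Prop :=
  [/\ (forall x, act one x = x),
      (forall g h x, act (mul g h) x = act g (act h x)) &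
      continuous (fun p : G * X => act p.1 p.2)].

Definition polish_G_space (G X : topologicalType)
    (mul : G -> G -> G) (one : G) (act : G -> X -> X) : Prop :=
  polish X /\ continuous_action mul one act.

(* Main.v *)
From HB Require Import structures.
Require Import Defs.
From mathcomp Require Import all_boot all_order all_algebra.
From mathcomp Require Import all_classical all_reals all_analysis.
From mathcomp Require Import Rstruct Rstruct_topology lra.

(* A point y of a Polish G-space Y is encoded by the family of closed sets
   F_n = closure {g | g y \in O_n}, where the O_n form a countable family of open
   sets of Y, indexed by the nodes of a tree. The topology on such families
   generated by the conditions "F_n meets V", with V a basic open set of G (the
   lower Vietoris topology), makes the encoding continuous and right translation
   by G jointly continuous, but it is only T0. Regularity is recovered by
   recording in the tree how O_n is exhausted: O_n is the union of sets O_{n,i}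
   such that the closure of V_i O_{n,i} lies in O_n, with V_i a neighbourhood of
   the identity, and the complement O'_{n,i} of this closure also belongs to the
   family. For the F_n this reads: F_n and F'_{n,i} cover G, V_i F_{n,i} misses
   F'_{n,i}, and F_n is the closure of the union of the F_{n,i}. The thickening by
   V_i is what allows these conditions to survive the passage to closures. The
   space X of all families satisfying them is second countable, regular, and cut
   out by countably many implications between open conditions, hence Polish, and
   it does not depend on Y. *)

Set Implicit Arguments.
Unset Strict Implicit.
Unset Printing Implicit Defensive.

Import Order.TTheory GRing.Theory Num.Theory.
Import numFieldNormedType.Exports.

Local Open Scope classical_set_scope.
Local Open Scope ring_scope.

(** * Complete metrics from closed embeddings into powers of the line *)

(** Only finitely many indices have code below [N], so a finite intersection over ['I_N]
    suffices. *)
Lemma filter_forall_pickle (I : countType) (T : Type) (F : set_system T)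
    (P : I -> T -> Prop) (N : nat) :
  Filter F -> (forall i, \forall x \near F, P i x) ->
  \forall x \near F, forall i, (pickle i < N)%N -> P i x.
Proof.
move=> FF FP.
have : \forall x \near F, forall n : 'I_N, forall i, pickle i = n -> P i x.
  apply: filter_forall => n.
  have [[i ni]|nn] := pselect (exists i : I, pickle i = n).
    apply: filterS (FP i) => x Px j jn.
    by rewrite (_ : j = i)//; apply: (pcan_inj pickleK); rewrite jn ni.
  by apply: nearW => x j jn; exfalso; apply: nn; exists j.
by apply: filterS => x Px i iN; exact: (Px (Ordinal iN)).
Qed.

Section complete_metric.
Variable R : realType.

(* [compatible_complete_metric] over an abstract [realType]: the normed structure
   of the line is not inferred on Stdlib's [R] itself. *)
Definition complete_metric (T : topologicalType) (d : T -> T -> R) : Prop :=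
  [/\ (forall x y, (0 <= d x y) /\ (d x y = 0 <-> x = y)),
      (forall x y, d x y = d y x),
      (forall x y z, (d x z <= d x y + d y z)),
      (forall A : set T, open A <->
         (forall x, A x -> exists e : R, (0 < e) /\
             forall y, (d x y < e) -> A y)) &
      (forall u : nat -> T,
         (forall e : R, (0 < e) -> exists N : nat,
             forall m n : nat, (leq N m) -> (leq N n) -> (d (u m) (u n) < e)) ->
         exists l : T, forall e : R, (0 < e) -> exists N : nat,
             forall n : nat, (leq N n) -> (d (u n) l < e))].

Lemma natSinv_lt (e : R) : 0 < e -> exists N : nat, N.+1%:R^-1 < e.
Proof.
move=> e0; have [N _ /(_ N)] := near_infty_natSinv_lt (PosNum e0).
by rewrite /= leqnn => /(_ isT); exists N.
Qed.

(** * Truncated suprema over a countable index set *)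

Section weighted_sup.
Variable I : countType.
Implicit Types a : I -> R.

Definition weight (i : I) : R := (pickle i).+1%:R^-1.

Lemma weight_gt0 i : 0 < weight i.
Proof. by rewrite invr_gt0. Qed.

(** Truncation by weights tending to 0 lets only finitely many coordinates exceed a given positive
    bound. Adjoining 0 keeps the set nonempty when [I] is empty. *)
Definition wsup_set a : set R :=
  [set x | x = 0 \/ exists i, x = Num.min (weight i) (a i)].

Definition wsup a : R := sup (wsup_set a).

Lemma wsup_set_bounded a : has_ubound (wsup_set a).
Proof.
exists 1 => x [->//|[i ->]]; rewrite ge_min; apply/orP; left.
by rewrite invf_le1// ler1n.
Qed.

Lemma wsup_ge a i : Num.min (weight i) (a i) <= wsup a.
Proof. by apply: ub_le_sup; [exact: wsup_set_bounded|right; exists i]. Qed.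

Lemma wsup_ge0 a : 0 <= wsup a.
Proof. by apply: ub_le_sup; [exact: wsup_set_bounded|left]. Qed.

Lemma wsup_le a c : 0 <= c -> (forall i, Num.min (weight i) (a i) <= c) ->
  wsup a <= c.
Proof.
move=> c0 ac; apply: ge_sup; first by exists 0; left.
by move=> x [->//|[i ->]].
Qed.

Lemma wsup_exists a c : 0 <= c -> c < wsup a ->
  exists i, c < weight i /\ c < a i.
Proof.
move=> c0 ca; apply: contrapT => nc.
move: ca; rewrite ltNge => /negP; apply; apply: wsup_le => // i.
rewrite leNgt lt_min; apply/negP => /andP ci.
by apply: nc; exists i.
Qed.

Lemma wsup_lt a e i : e <= weight i -> wsup a < e -> a i < e.
Proof.
move=> ei; move=> /(le_lt_trans (wsup_ge a i)); rewrite gt_min => /orP[|//].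
by rewrite ltNge ei.
Qed.

Lemma wsup_near (T : Type) (F : set_system T) (a : I -> T -> R) :
  Filter F -> (forall i e, 0 < e -> \forall x \near F, a i x < e) ->
  forall e, 0 < e -> \forall x \near F, wsup (a^~ x) < e.
Proof.
move=> FF aF e e0.
have e20 : 0 < e / 2 by rewrite divr_gt0.
have [N Ne] := natSinv_lt e20.
have := filter_forall_pickle N FF (fun i => aF i _ e20).
apply: filterS => x ax.
apply: (@le_lt_trans _ _ (e / 2)); last by rewrite ltr_pdivrMr// ltr_pMr// ltr1n.
apply: wsup_le; first exact: ltW.
move=> i; rewrite ge_min; apply/orP; have [iN|Ni] := ltnP (pickle i) N.
  by right; apply: ltW; exact: ax.
left; apply: le_trans (ltW Ne).
by rewrite /weight lef_pV2 ?posrE// ler_nat ltnS.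
Qed.

End weighted_sup.

Section closed_embedding.
Variables (T : topologicalType) (I : countType) (psi : I -> T -> R).

Hypothesis psi_continuous : forall i, continuous (psi i).
Hypothesis psi_initial : forall (A : set T) x, open A -> A x ->
  exists i, exists2 e : R, 0 < e & forall y, `|psi i x - psi i y| < e -> A y.
Hypothesis psi_inj : forall x y, (forall i, psi i x = psi i y) -> x = y.
Hypothesis psi_closed : forall u : nat -> T,
  (forall i (e : R), 0 < e -> exists N, forall m n, (N <= m)%N -> (N <= n)%N ->
     `|psi i (u m) - psi i (u n)| < e) ->
  exists l : T, u @ \oo --> l.

Let d x y := wsup (fun i => `|psi i x - psi i y|).

Let d_near x e : 0 < e -> nbhs x (fun y => d x y < e).
Proof.
move=> e0; apply: wsup_near => // i {e0}e e0.
by have /cvgrPdist_lt := @psi_continuous i x; apply.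
Qed.

Lemma closed_embedding_complete : exists d, @complete_metric T d.
Proof.
exists d; split.
- move=> x y; split; first exact: wsup_ge0.
  split=> [dxy|->]; last first.
    apply/eqP; rewrite eq_le wsup_ge0 andbT; apply: wsup_le => // i.
    by rewrite subrr normr0 ge_min lexx orbT.
  apply: psi_inj => i; apply/eqP; rewrite -subr_eq0 -normr_le0.
  have := @wsup_ge _ (fun i => `|psi i x - psi i y|) i.
  by rewrite -/(d x y) dxy ge_min leNgt weight_gt0.
- by move=> x y; congr wsup; apply: funext => i; rewrite distrC.
- move=> x y z; apply: wsup_le; first by rewrite addr_ge0// wsup_ge0.
  move=> i; have := @wsup_ge _ (fun i => `|psi i x - psi i y|) i.
  have := @wsup_ge _ (fun i => `|psi i y - psi i z|) i.
  rewrite -/(d x y) -/(d y z).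
  have := wsup_ge0 (fun i => `|psi i x - psi i y|).
  have := wsup_ge0 (fun i => `|psi i y - psi i z|).
  rewrite -/(d x y) -/(d y z).
  have := ler_distD (psi i y) (psi i x) (psi i z).
  rewrite !ge_min => t p q /orP[w1|n1] /orP[w2|n2]; apply/orP.
  + by left; apply: le_trans w1 _; rewrite lerDr.
  + by left; apply: le_trans w1 _; rewrite lerDr.
  + by left; apply: le_trans w2 _; rewrite lerDl.
  + by right; apply: le_trans t _; apply: lerD.
- move=> A; split=> [oA x Ax|dA].
    have [i [e e0 eA]] := psi_initial oA Ax.
    (* Below [weight i] the truncation is inactive, so [d] controls the [i]-th coordinate itself. *)
    exists (Num.min e (weight i)); split; first by rewrite lt_min e0 weight_gt0.
    move=> y xy; apply: eA; rewrite (@lt_le_trans _ _ (Num.min e (weight i)))//.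
      by apply: (wsup_lt (a := fun i => `|psi i x - psi i y|)) xy; rewrite ge_min lexx orbT.
    by rewrite ge_min lexx.
  rewrite openE => x /dA[e [e0 eA]]; apply: filterS (d_near x e0) => y; exact: eA.
- move=> u uC; have [i e e0|l ul] := psi_closed (u := u).
    have e'0 : 0 < Num.min e (weight i) by rewrite lt_min e0 weight_gt0.
    have [N uN] := uC _ e'0; exists N => m n Nm Nn.
    rewrite (@lt_le_trans _ _ (Num.min e (weight i)))//; last by rewrite ge_min lexx.
    apply: (wsup_lt (a := fun i => `|psi i (u m) - psi i (u n)|)) (uN _ _ Nm Nn).
    by rewrite ge_min lexx orbT.
  exists l => e e0; have /ul [N _ uN] := d_near l e0.
  exists N => n Nn; have := uN n Nn.
  by rewrite /= /d; under eq_fun do rewrite distrC.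
Qed.

End closed_embedding.

End complete_metric.

(** * Second countable regular spaces *)

Section countable_regular_base.
Variables (R : realType) (T : topologicalType) (I : countType) (B : I -> set T).
Hypothesis B_open : forall i, open (B i).
Hypothesis B_regular : forall (A : set T) x, open A -> A x ->
  exists2 i, B i x & closure (B i) `<=` A.

Lemma countable_regular_normal : normal_space T.
Proof.
apply/(@normal_openP R) => A C clA clC AC.
(* From each basic set whose closure misses [E], remove the closures missing [E'] with code at most
   its own. At a common point of the two halves, the witness of smaller code would have been removed
   by the other half. *)
pose half (E E' : set T) := [set x | exists i, [/\ B i x,
  closure (B i) `&` E = set0 & forall j, (pickle j < (pickle i).+1)%N ->
    closure (B j) `&` E' = set0 -> ~ closure (B j) x]].
have half_open E E' : open (half E E').
  rewrite openE => x [i [Bx iE xE']].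
  have near_xE' : \forall y \near x, forall j, (pickle j < (pickle i).+1)%N ->
      closure (B j) `&` E' = set0 -> ~ closure (B j) y.
    suff : \forall y \near x, forall j, (pickle j < (pickle i).+1)%N ->
      [set y | (pickle j < (pickle i).+1)%N -> closure (B j) `&` E' = set0 -> ~ closure (B j) y] y.
      by apply: filterS => y h j ji; exact: h.
    apply: filter_forall_pickle => j.
    have [[ji jE']|nj] := pselect ((pickle j < (pickle i).+1)%N /\ closure (B j) `&` E' = set0).
      have : nbhs x (~` closure (B j)).
        by apply: open_nbhs_nbhs; split; [exact/closed_openC/closed_closure|exact: xE'].
      by apply: filterS => y ny _ _.
    by apply: nearW => y ji jE'; exfalso; apply: nj.
  have near_B : \forall y \near x, B i y by exact: open_nbhs_nbhs.
  by apply: filterS2 near_B near_xE' => y By yE'; exists i.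
have half_sub E E' : closed E -> E' `&` E = set0 -> E' `<=` half E E'.
  move=> clE EE' x E'x.
  have [|i Bx BE] := B_regular (closed_openC clE) (x := x).
    by move=> Ex; have : (E' `&` E) x by []; rewrite EE'.
  exists i; split=> //; first by rewrite -subset0 => y [/BE].
  move=> j _ jE' jx; have : (closure (B j) `&` E') x by [].
  by rewrite jE'.
exists (half C A), (half A C); split=> //.
- exact: half_sub.
- by apply: half_sub => //; rewrite setIC.
- rewrite -subset0 => x [[i [ix iC ix']] [j [jx jA jx']]].
  have [ji|ij] := leqP (pickle j) (pickle i).
    by apply: (ix' j) => //; exact: subset_closure.
  by apply: (jx' i) => //; [exact: ltnW|exact: subset_closure].
Qed.

(** The zero function serves the pairs without inclusion, so that one family of functions can be
    indexed by all pairs. *)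
Lemma urysohn_pair (a b : I) : exists f : T -> R,
  [/\ continuous f, forall x, f x != 0 -> B b x &
      closure (B a) `<=` B b -> forall x, B a x -> f x = 1].
Proof.
have [ab|nab] := pselect (closure (B a) `<=` B b); last first.
  exists (fun=> 0); split=> //.
  - by move=> x; exact: cvg_cst.
  - by move=> x; rewrite eqxx.
have cB : closed (~` B b) by exact: open_closedC.
have := countable_regular_normal.
move=> /(@normal_separatorP R)/(_ _ _ cB (@closed_closure _ (B a))).
have -> : ~` B b `&` closure (B a) = set0.
  by rewrite -subset0 => x [nx /ab].
move=> /(_ erefl) /(@uniform_separatorP _ R)[f [cf _ f0 f1]]; exists f; split=> //.
- move=> x fx; apply: contrapT => nBx; move/negP: fx; apply; apply/eqP.
  by apply: f0; exists x.
- by move=> _ x ax; apply: f1; exists x => //; exact: subset_closure.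
Qed.

(* A complete metric comes from the closed embedding into a countable power of
   [R] given by Urysohn functions together with the functions [1 / w k], where
   [w k] is positive and keeps away from [0] only on finite unions of members of
   the [k]-th cover. *)
Theorem complete_metric_of_covers (K : countType) (C : K -> set (set T)) :
  (forall x y, (forall i, B i x <-> B i y) -> x = y) ->
  (forall k U, C k U -> open U) ->
  (forall k x, exists2 U, C k U & U x) ->
  (forall u : nat -> T,
    (forall k, exists2 U, C k U & \forall n \near \oo, U (u n)) ->
    exists l : T, u @ \oo --> l) ->
  exists d : T -> T -> R, complete_metric d.
Proof.
move=> T0 Copen Ccover Ccomplete.
have /choice[f fP] : forall ab : I * I, exists f : T -> R,
  [/\ continuous f, forall x, f x != 0 -> B ab.2 x &
      closure (B ab.1) `<=` B ab.2 -> forall x, B ab.1 x -> f x = 1].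
  by case=> a b; exact: urysohn_pair.
have f_base (A : set T) x : open A -> A x ->
    exists a b, [/\ f (a, b) x = 1, B b x & B b `<=` A].
  move=> oA Ax; have [b bx bA] := B_regular oA Ax.
  have [a ax ab] := B_regular (B_open b) bx.
  exists a, b; split=> //; first by have [_ _] := fP (a, b); apply.
  exact: subset_trans (@subset_closure _ (B b)) bA.
pose sub k (ab : I * I) := `[< exists2 U, C k U & B ab.2 `<=` U >].
pose g k ab x : R := if sub k ab then f ab x else 0.
pose w k x := wsup (fun ab => g k ab x).
have w_gt0 k x : 0 < w k x.
  have [U CU Ux] := Ccover k x.
  have [a [b [fx bx bU]]] := f_base _ _ (Copen _ _ CU) Ux.
  apply: lt_le_trans (wsup_ge _ (a, b)); rewrite lt_min weight_gt0 /=.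
  by rewrite /g ifT ?fx//; apply/asboolP; exists U.
have w_continuous k : continuous (w k).
  move=> x; apply/cvgrPdist_lt => e e0.
  have : \forall y \near x, wsup (fun ab => `|g k ab x - g k ab y|) < e.
    apply: wsup_near => // ab {}e {}e0.
    rewrite /g; case: ifP => _; last by apply: nearW => y; rewrite subrr normr0.
    by have [fc _ _] := fP ab; have /cvgrPdist_lt := fc x; apply.
  apply: filterS => y; apply: le_lt_trans.
  (* [w k] is 1-Lipschitz for the weighted sup distance of the [g k ab]; exchanging [z] and [t]
     gives continuity. *)
  have key z t : w k z <= w k t + wsup (fun ab => `|g k ab z - g k ab t|).
    apply: wsup_le; first by rewrite addr_ge0// wsup_ge0.
    move=> ab; have := wsup_ge (fun ab => g k ab t) ab.
    have := wsup_ge (fun ab => `|g k ab z - g k ab t|) ab.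
    rewrite -/(w k t).
    have := wsup_ge0 (fun ab => `|g k ab z - g k ab t|).
    have := w_gt0 k t; move: (w k t) (wsup _) => W V W0 V0.
    have := ler_norm (g k ab z - g k ab t).
    move: (weight_gt0 R ab) => + + + +.
    rewrite !ge_min => h gg /orP[p|p] /orP[q|q]; apply/orP; lra.
  rewrite ler_norml; apply/andP; split; last by rewrite lerBlDl key.
  rewrite lerNl opprB lerBlDl; under eq_fun do rewrite distrC.
  exact: key.
pose psi (i : (I * I) + K) x : R :=
  match i with inl ab => f ab x | inr k => (w k x)^-1 end.
apply: (@closed_embedding_complete R T ((I * I) + K)%type psi).
- case=> [ab|k]; first by have [] := fP ab.
  move=> x; apply: cvgV; first by rewrite gt_eqF.
  exact: w_continuous.
- move=> A x oA Ax; have [a [b [fx bx bA]]] := f_base _ _ oA Ax.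
  exists (inl (a, b)), 1 => // y /=; rewrite fx => fy; apply: bA.
  have [_ fB _] := fP (a, b); apply: fB; apply/eqP => fy0.
  by move: fy; rewrite fy0 subr0 normr1 ltxx.
- have half_sep x y : (forall i, psi i x = psi i y) -> forall i, B i x -> B i y.
    move=> xy i ix; have [a [b [fx bx bA]]] := f_base _ _ (B_open i) ix.
    apply: bA; have [_ fB _] := fP (a, b); apply: fB.
    by rewrite -[f _ y]/(psi (inl (a, b)) y) -xy /= fx oner_neq0.
  move=> x y xy; apply: T0 => i; split; first exact: half_sep.
  by apply: half_sep => j; rewrite xy.
- move=> u uC; apply: Ccomplete => k.
  have [N uN] := uC (inr k) 1 ltr01.
  (* After [N] the coordinate [1 / w k] moves by less than 1, so [w k] stays above [1 / M]. A
     coordinate witnessing this has weight above [1 / M], hence code below [P]. After [Q] these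
     finitely many functions vary by less than [1 / M], so the witness at [u n] never vanishes later
     and its support traps the sequence. *)
  pose M := (w k (u N))^-1 + 1.
  have M0 : 0 < M by rewrite ltr_wpDl// invr_ge0 ltW.
  have uM n : (N <= n)%N -> M^-1 < w k (u n).
    move=> Nn; rewrite invf_plt ?posrE//.
    have := uN _ _ (leqnn N) Nn; rewrite /= => /ltr_distlCDr.
    exact.
  have MV0 : 0 < M^-1 by rewrite invr_gt0.
  have [P wP] : exists P : nat, P.+1%:R^-1 < M^-1.
    exact: natSinv_lt.
  have : \forall n \near \oo, forall ab : I * I, (pickle ab < P)%N ->
      forall m, (n <= m)%N -> `|f ab (u n) - f ab (u m)| < M^-1.
    apply: filter_forall_pickle => ab.
    have [Q uQ] := uC (inl ab) M^-1 MV0.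
    exists Q => // n /= Qn m nm; apply: uQ => //; exact: leq_trans nm.
  move=> [Q _ uQ].
  pose n := maxn N Q.
  have [ab [wab gab]] := wsup_exists (ltW MV0) (uM n (leq_maxl _ _)).
  have abP : (pickle ab < P)%N.
    rewrite ltnNge; apply/negP => Pab; have := lt_trans wP wab.
    by rewrite ltf_pV2 ?posrE// ltr_nat ltnS ltnNge Pab.
  move: gab; rewrite /g; case: ifP => [/asboolP[U CU abU] fab|_]; last first.
    by rewrite invr_lt0 ltNge (ltW M0).
  exists U => //; exists n => // m /= nm; apply: abU.
  have [_ fB _] := fP ab; apply: fB.
  have := uQ n (leq_maxr _ _) ab abP m nm.
  by apply: contraTneq => ->; rewrite subr0 -leNgt (le_trans (ltW fab))// ler_norm.
Qed.

End countable_regular_base.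

(** * Topologies given by a subbase *)

(** The alias carries [S], so that the topology attached to the type can depend on the subbase. *)
Definition subbase_space (T : Type) (I : eqType) (S : I -> set T) : Type := T.

Section subbase_topology.
Variables (T : Type) (I : eqType) (S : I -> set T).
Let X := subbase_space S.

HB.instance Definition _ := gen_eqMixin X.
HB.instance Definition _ := gen_choiceMixin X.

Definition subbase_cell (s : seq I) : set X := [set x | forall i, i \in s -> S i x].

Definition subbase_open : set_system X := [set A | forall x, A x ->
  exists2 s, subbase_cell s x & subbase_cell s `<=` A].

Lemma subbase_cell_cat s t :
  subbase_cell (s ++ t) = subbase_cell s `&` subbase_cell t.
Proof.
apply/seteqP; split=> x.
  by move=> st; split=> i ii; apply: st; rewrite mem_cat ii ?orbT.
by move=> [xs xt] i; rewrite mem_cat => /orP[/xs|/xt].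
Qed.

Let openT : subbase_open setT.
Proof. by move=> x _; exists [::]. Qed.

Let openI : setI_closed subbase_open.
Proof.
move=> A B oA oB x [/oA[s xs sA] /oB[t xt tB]]; exists (s ++ t).
  by rewrite subbase_cell_cat.
by rewrite subbase_cell_cat; exact: setISS.
Qed.

Let open_bigU (J : Type) (f : J -> set X) :
  (forall j, subbase_open (f j)) -> subbase_open (\bigcup_j f j).
Proof.
move=> of_ x [j _ /of_[s xs sf]]; exists s => //.
by move=> y /sf; exists j.
Qed.

HB.instance Definition _ := isOpenTopological.Build X openT openI open_bigU.

Lemma nbhs_subbase (x : X) A :
  nbhs x A <-> exists2 s, subbase_cell s x & subbase_cell s `<=` A.
Proof.
split=> [[B [oB Bx BA]]|[s xs sA]].
  by have [s xs sB] := oB x Bx; exists s => //; exact: subset_trans BA.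
by exists (subbase_cell s); split=> // y ys; exists s.
Qed.

Lemma open_subbase_cell s : open (subbase_cell s).
Proof. by rewrite openE => x xs; apply/nbhs_subbase; exists s. Qed.

Lemma open_subbase i : open (S i : set X).
Proof.
rewrite (_ : S i = subbase_cell [:: i]); first exact: open_subbase_cell.
apply/seteqP; split=> x; first by move=> ix j; rewrite inE => /eqP ->.
by apply; rewrite inE.
Qed.

Lemma cvg_subbase (F : set_system X) (x : X) : Filter F ->
  (forall i, S i x -> F (S i)) -> F --> x.
Proof.
move=> FF FS A /nbhs_subbase[s xs sA]; apply: filterS sA _.
elim: s xs => [|i s IH] xs; first by apply: filterS (@filterT _ F _).
have Fs : F (subbase_cell s) by apply: IH => j js; apply: xs; rewrite inE js orbT.
have Fi : F (S i) by apply: FS; apply: xs; rewrite inE eqxx.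
apply: filterS2 Fi Fs => y yi ys j; rewrite inE => /orP[/eqP->//|]; exact: ys.
Qed.

End subbase_topology.

Arguments subbase_cell {T I} S s.

(** * Polishness of a topology with a countable subbase *)

Section polish_subbase.
Variables (T : Type) (I : countType) (S : I -> set T).
Let X := subbase_space S.

(* [separates m l n]: the closed set [~` S l] lies between [S m] and [S n]. *)
Definition separates m l n :=
  (forall x, ~ (S m x /\ S l x)) /\ (forall x, S n x \/ S l x).

Hypothesis S_T0 : forall x y, (forall i, S i x <-> S i y) -> x = y.
Hypothesis S_regular : forall x n, S n x ->
  exists m l, S m x /\ separates m l n.

Lemma separates_sub m l n : separates m l n -> S m `<=` S n.
Proof. by move=> [ml nl] x mx; have [//|lx] := nl x; case: (ml x). Qed.

(** If [separates m l n], the closure of [S m] misses the open set [S l], hence lies in [S n]. Cells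
    are shrunk one index at a time. *)
Lemma subbase_cell_regular (A : set X) x : open A -> A x ->
  exists2 s : seq I, subbase_cell S s x & closure (subbase_cell S s : set X) `<=` A.
Proof.
move=> oA Ax; have /nbhs_subbase[s xs sA] : nbhs x A by exact: open_nbhs_nbhs.
suff [t xt ts] : exists2 t : seq I, subbase_cell S t x &
    closure (subbase_cell S t : set X) `<=` subbase_cell S s.
  by exists t => //; exact: subset_trans sA.
elim: s xs {sA} => [|n s IH] xs; first by exists [::].
have [|t xt ts] := IH; first by move=> j js; apply: xs; rewrite inE js orbT.
have [|m [l [mx [ml nl]]]] := S_regular (x := x) (n := n).
  by apply: xs; rewrite inE eqxx.
exists (m :: t).
  by move=> j; rewrite inE => /orP[/eqP->//|]; exact: xt.
move=> y ymt j; rewrite inE => /orP[/eqP->|js].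
  have [//|ly] := nl y.
  have : nbhs (y : X) (S l).
    by apply: open_nbhs_nbhs; split=> //; exact: open_subbase.
  move=> /ymt[z [zm zl]]; exfalso; apply: (ml z); split=> //.
  by apply: zm; rewrite inE eqxx.
apply: ts js => U /ymt[z [zm zU]]; exists z; split=> // i it.
by apply: zm; rewrite inE it orbT.
Qed.

Lemma subbase_separable : exists D : set X, countable D /\ dense D.
Proof.
have [[x0]|nX] := pselect (inhabited X); last first.
  exists set0; split; first exact: countable0.
  by move=> O [x _]; exfalso; apply: nX; exists.
pose p (s : seq I) := xget x0 (subbase_cell S s).
exists (range p); split; first by apply: card_le_trans (card_image_le _ _) _; exact: countableP.
move=> O [x Ox] oO.
have /nbhs_subbase[s xs sO] : nbhs x O by exact: open_nbhs_nbhs.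
by exists (p s); split; [apply: sO; exact: xgetPex (ex_intro _ x xs)|exists s].
Qed.

(* The last hypothesis says that the points of [X] are exactly the sets of
   indices which are prime with respect to countably many infinitary
   disjunctions [J k]. *)
Theorem subbase_polish (K : countType) (J : K -> set I) :
  (forall (u : nat -> T) (P : set I),
    (forall i, P i -> \forall n \near \oo, S i (u n)) ->
    (forall i j, S i `<=` S j -> P i -> P j) ->
    (forall k, setT `<=` \bigcup_(i in J k) S i -> exists2 i, J k i & P i) ->
    (forall k j, P j -> S j `<=` \bigcup_(i in J k) S i ->
      exists2 i, J k i & P i) ->
    exists x, forall i, S i x -> P i) ->
  polish X.
Proof.
move=> prime_point; split; first exact: subbase_separable.
(* The sets [S i] with [i] in [J k], together with [S l] when [o] is [Some l], cover [X]. Where this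
   fails, [C] is the trivial cover, so every index gives a cover. *)
pose cond (ko : K * option I) : Prop := forall x,
  (exists2 i, J ko.1 i & S i x) \/ (exists2 l, ko.2 = Some l & S l x).
pose C (ko : K * option I) : set (set X) := [set U |
  (cond ko -> (exists i m l, [/\ J ko.1 i, separates m l i & U = S m]) \/
    (exists2 l, ko.2 = Some l & U = S l)) /\ (~ cond ko -> U = setT)].
apply: (@complete_metric_of_covers _ X (seq I) (subbase_cell S) _ _
  (K * option I)%type C).
- exact: open_subbase_cell.
- exact: subbase_cell_regular.
- move=> x y xy; apply: S_T0 => i.
  have := xy [:: i]; rewrite /subbase_cell/= => -[xyi yxi]; split=> h.
    by apply: xyi; rewrite ?inE// => j; rewrite inE => /eqP->.
  by apply: yxi; rewrite ?inE// => j; rewrite inE => /eqP->.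
- move=> ko U [CU nCU]; have [/CU|/nCU->] := pselect (cond ko).
    by move=> [[i [m [l [_ _ ->]]]]|[l _ ->]]; exact: open_subbase.
  exact: openT.
- move=> ko x; have [ck|nck] := pselect (cond ko); last by exists setT.
  have [[i Ji ix]|[l kl lx]] := ck x.
    have [m [l [mx sep]]] := S_regular ix.
    by exists (S m) => //; split=> // _; left; exists i, m, l.
  by exists (S l) => //; split=> // _; right; exists l.
- move=> u uC.
  pose P : set I := [set i | exists m l, separates m l i /\
    \forall n \near \oo, S m (u n)].
  have PS i : P i -> \forall n \near \oo, S i (u n).
    by move=> [m [l [/separates_sub mi]]]; apply: filterS => n; exact: mi.
  have [] := prime_point u P => //.
  + move=> i j ij [m [l [[ml il] um]]]; exists m, l; split=> //; split=> // x.
    by have [/ij|] := il x; [left|right].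
  + move=> k Jk; have [U [CU _] uU] := uC (k, None).
    have [x|[i [m [l [Ji sep Um]]]]|[]//] := CU.
      by have [//|i Ji ix] := Jk x; left; exists i.
    by exists i => //; exists m, l; rewrite -Um.
  (* A disjunction below [S j] becomes a cover of [X] once [S l] is added. The sequence is
     eventually in [S m], disjoint from [S l], so it cannot be trapped in the added set. *)
  + move=> k j [m [l [[ml jl] um]]] Jj.
    have [U [CU _] uU] := uC (k, Some l).
    have [x|[i [m' [l' [Ji sep Um]]]]|[l' [<-] Ul]] := CU.
    * by have [/Jj[i Ji ix]|] := jl x; [left; exists i|right; exists l].
    * by exists i => //; exists m', l'; rewrite -Um.
    * exfalso; rewrite Ul in uU.
      by have [n [mn ln]] := filter_ex (filterI um uU); apply: (ml (u n)).
  + move=> x Px; exists x; apply: cvg_subbase => i /Px; exact: PS.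
Qed.

End polish_subbase.

(** * Bases of Polish spaces *)

(* [small q k] stands for: the basic open set [V k] has diameter at most
   [1 / (q + 1)]. *)
Definition complete_base (T : topologicalType) (K : Type)
    (V : K -> set T) (small : nat -> K -> Prop) : Prop :=
  [/\ forall k, open (V k),
      forall q (A : set T) x, open A -> A x ->
        exists k, [/\ V k x, small q k & closure (V k) `<=` A],
      forall x y : T, x <> y -> exists A, [/\ open A, A x & ~ A y] &
      forall s : nat -> K, (forall q, V (s q) !=set0) ->
        (forall q, small q (s q.+1)) -> (forall q, V (s q.+1) `<=` V (s q)) ->
        exists x, (forall q, closure (V (s q)) x) /\
          forall A : set T, open A -> A x -> exists q, V (s q) `<=` A].

Lemma complete_metric_base (R : realType) (T : topologicalType)
    (D : set T) (d : T -> T -> R) :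
  countable D -> dense D -> complete_metric d ->
  exists (V : nat * nat -> set T) small, complete_base V small.
Proof.
move=> /pcard_leP[f] denseD [d0 dC dD dopen dcomplete].
have dP x y : d x y = 0 <-> x = y by have [] := d0 x y.
have dxx x : d x x = 0 by apply/dP.
have ball_open x e : open [set y | d x y < e].
  apply/dopen => y /= xy; exists (e - d x y); split; first by rewrite subr_gt0.
  by move=> z yz; apply: le_lt_trans (dD x y z) _; rewrite -ltrBrDl.
(* A ball about the point of [D] with code [k.1], empty if there is no such point. *)
pose V (k : nat * nat) : set T :=
  [set y | exists x, [/\ D x, f x = k.1 & d x y < k.2.+1%:R^-1]].
pose small q (k : nat * nat) := forall x y, V k x -> V k y -> d x y < q.+1%:R^-1.
exists V, small; split.
- move=> k; apply/dopen => y [x [Dx fx xy]].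
  have /dopen/(_ y xy)[e [e0 eV]] := ball_open x k.2.+1%:R^-1.
  by exists e; split=> // z /eV xz; exists x.
- move=> q A z oA Az; have /dopen/(_ z Az)[e [e0 eA]] := oA.
  (* Twice the radius bounds the diameter of the ball and the distance from [z] to its points; the
     slack below [e] absorbs the passage to the closure. *)
  have [r [re rq]] : exists r : nat, r.+1%:R^-1 + r.+1%:R^-1 < e /\
      r.+1%:R^-1 + r.+1%:R^-1 < q.+1%:R^-1 :> R.
    have [|r] := @natSinv_lt R (Num.min e q.+1%:R^-1 / 2).
      by rewrite divr_gt0// lt_min e0 invr_gt0 ltr0n.
    rewrite ltr_pdivlMr// mulr_natr mulr2n lt_min => /andP[re rq].
    by exists r.
  have r0 : 0 < r.+1%:R^-1 :> R by rewrite invr_gt0.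
  have [|x [zx Dx]] := denseD [set y | d z y < r.+1%:R^-1] _ (ball_open _ _).
    by exists z; rewrite /= dxx.
  have V_ball x' y : D x' -> f x' = f x -> d x' y < r.+1%:R^-1 ->
      d x y < r.+1%:R^-1.
    move=> Dx' fx'; suff -> : x' = x by [].
    by apply: (@inj _ _ _ f); rewrite ?inE.
  exists (f x, r); split.
  + by exists x; rewrite dC.
  + move=> y y' [x1 [Dx1 fx1 xy]] [x2 [Dx2 fx2 xy']].
    apply: le_lt_trans (dD y x y') _; apply: lt_trans rq; rewrite dC.
    by apply: ltrD; [exact: V_ball xy|exact: V_ball xy'].
  + move=> y Vy; apply: eA.
    have [|y' [[x1 [Dx1 fx1 xy']] yy']] :=
        Vy [set y' | d y y' < e - (r.+1%:R^-1 + r.+1%:R^-1)].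
      by apply: open_nbhs_nbhs; split; [exact: ball_open|rewrite /= dxx subr_gt0].
    have {}xy' := V_ball _ _ Dx1 fx1 xy'.
    have := dD z x y; have := dD x y' y; rewrite (dC y' y).
    move: zx xy' yy' => /=; move: (r.+1%:R^-1) => c; lra.
- move=> x y xy; exists [set z | d x z < d x y]; split=> //=; last by rewrite ltxx.
  rewrite dxx lt_neqAle eq_sym (proj1 (d0 x y)) andbT; apply/eqP.
  by move=> /dP.
- move=> s Vs small_s Vsub.
  have [g gP] := choice Vs.
  have sub m n : (m <= n)%N -> V (s n) `<=` V (s m).
    move=> /subnK <-; elim: (n - m)%N => [//|i IH].
    by rewrite addSn; exact: subset_trans (Vsub _) IH.
  have gs q y m : V (s q.+1) y -> (q < m)%N -> d (g m) y < q.+1%:R^-1.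
    by move=> Vy qm; apply: small_s => //; apply: (sub q.+1 m).
  have [|x gx] := dcomplete g.
    move=> e e0; have [q qe] := natSinv_lt e0; exists q.+1 => m n qm qn.
    by apply: lt_trans qe; apply: gs => //; apply: (sub q.+1 n).
  exists x; split=> [q A|A oA Ax].
    rewrite nbhsE => -[U [oU Ux] UA].
    have /dopen/(_ x Ux)[e [e0 eU]] := oU.
    have [N gN] := gx e e0; exists (g (maxn N q)); split.
      by apply: (sub q (maxn N q)) => //; exact: leq_maxr.
    by apply: UA; apply: eU; rewrite dC; apply: gN; exact: leq_maxl.
  have /dopen/(_ x Ax)[e [e0 eA]] := oA.
  have e20 : 0 < e / 2 by rewrite divr_gt0.
  have [N gN] := gx _ e20; have [q qe] := natSinv_lt e20.
  (* Smallness at level [q] is given for [s q.+1]. All points of this set are within [e / 2] of a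
     term of [g] that is itself within [e / 2] of [x]. *)
  exists q.+1 => y /gs Vy; apply: eA.
  have := gN (maxn N q.+1) (leq_maxl _ _).
  have := Vy (maxn N q.+1) (leq_maxr _ _).
  have := dD x (g (maxn N q.+1)) y; rewrite (dC x (g _)).
  move: qe; move: (q.+1%:R^-1) => c; lra.
Qed.

Lemma polish_complete_base (T : topologicalType) : polish T ->
  exists (V : nat * nat -> set T) small, complete_base V small.
Proof.
by move=> [[D [cD dD]] [d dP]]; exact: (complete_metric_base cD dD dP).
Qed.

Lemma continuous2_nbhs (T1 T2 T3 : topologicalType) (f : T1 -> T2 -> T3) x y A :
  continuous (fun p : T1 * T2 => f p.1 p.2) -> nbhs (f x y) A ->
  exists P Q, [/\ nbhs x P, nbhs y Q & forall p q, P p -> Q q -> A (f p q)].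
Proof.
move=> /(_ (x, y)) fc /fc[[P Q] /= [xP yQ] PQ]; exists P, Q; split=> // p q Pp Qq.
exact: (PQ (p, q)).
Qed.

(** * The universal space *)

Lemma nbhs_meets (T : topologicalType) (A U : set T) x :
  closure A x -> open U -> U x -> A `&` U !=set0.
Proof. by move=> Ax oU Ux; apply: Ax; exact: open_nbhs_nbhs. Qed.

Section universal_space.
Variables (G : topologicalType) (mul : G -> G -> G) (one : G) (inv : G -> G).
Hypothesis groupG : topological_group mul one inv.
Variables (V : nat * nat -> set G) (small : nat -> nat * nat -> Prop).
Hypothesis baseV : complete_base V small.

Local Notation "x ** y" := (mul x y) (at level 40, left associativity).

Let mulA x y z : x ** (y ** z) = x ** y ** z.
Proof. by have [h _ _ _ _] := groupG. Qed.

Let mul1 x : x ** one = x.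
Proof. by have [_ h _ _ _] := groupG; have [] := h x. Qed.

Let mulV x : x ** inv x = one.
Proof. by have [_ _ h _ _] := groupG; have [] := h x. Qed.

Let mulKV x y : x ** inv y ** y = x.
Proof.
have [_ _ h _ _] := groupG; have [yV _] := h y.
by rewrite -mulA yV mul1.
Qed.

Let mulK x y : x ** y ** inv y = x.
Proof. by rewrite -mulA mulV mul1. Qed.

Let mul_nbhs x y A : nbhs (x ** y) A ->
  exists P Q, [/\ nbhs x P, nbhs y Q & forall p q, P p -> Q q -> A (p ** q)].
Proof. by have [_ _ _ mulC _] := groupG; exact: continuous2_nbhs. Qed.

Let div_nbhs x y A : nbhs (x ** inv y) A ->
  exists P Q, [/\ nbhs x P, nbhs y Q & forall p q, P p -> Q q -> A (p ** inv q)].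
Proof.
move=> /mul_nbhs[P [Q [xP yQ PQ]]]; exists P, (inv @^-1` Q); split=> //.
- by have [_ _ _ _ invC] := groupG; exact: invC.
- by move=> p q Pp Qq; exact: PQ.
Qed.

Let nbhs_mulr x y A : nbhs (x ** y) A -> nbhs x [set z | A (z ** y)].
Proof.
move=> /mul_nbhs[P [Q [xP yQ PQ]]]; apply: filterS xP => z Pz.
by apply: PQ => //; exact: nbhs_singleton.
Qed.

Let V_open k : open (V k). Proof. by have [] := baseV. Qed.

Let V_nbhs k x : V k x -> nbhs x (V k).
Proof. by move=> kx; exact: open_nbhs_nbhs. Qed.

Let V_base A x : nbhs x A -> exists2 k, V k x & V k `<=` A.
Proof.
rewrite nbhsE => -[U [oU Ux] UA]; have [_ h _ _] := baseV.
have [k [kx _ kU]] := h 0%N U x oU Ux; exists k => //.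
exact: subset_trans (subset_trans (@subset_closure _ _) kU) UA.
Qed.

(* An address is a path, read from the right, in the tree of open sets of a
   [G]-space defined by [tree_open] below. *)
Definition address := seq (bool * ((nat * nat) * (nat * nat))).

(* [F n] stands for the closure of [{g | g y \in O n}], where [O] assigns open sets
   to addresses, with [O ((true, i) :: n)] the complement of the closure of
   [V i.1 * O ((false, i) :: n)]. Each clause is invariant under right
   translation, which makes the universal space a [G]-space, and is a countable
   conjunction of implications between open conditions. *)
Definition coherent (F : address -> set G) : Prop :=
  [/\ forall n, closed (F n),
      F [::] = setT,
      forall n i g, F n g \/ F ((true, i) :: n) g,
      forall n i v g, V i.1 v -> F ((false, i) :: n) g ->
        ~ F ((true, i) :: n) (v ** g) &
      forall n g U, F n g -> nbhs g U ->
        exists2 i, V i.1 one & F ((false, i) :: n) `&` U !=set0].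

Definition coherent_family := {F : address -> set G | coherent F}.

Lemma coherent_shift F h :
  coherent F -> coherent (fun n => [set g | F n (g ** h)]).
Proof.
move=> [cF F0 Fcover Fdisj Frefine]; split.
- move=> n g gF; apply: cF => A /nbhs_mulr/gF[x [xF xA]].
  by exists (x ** h).
- by rewrite F0.
- by move=> n i g; exact: Fcover.
- by move=> n i v g iv Fg; rewrite /= -mulA; exact: Fdisj.
- move=> n g U Fg gU.
  have /nbhs_mulr/(Frefine _ _ _ Fg)[i i1 [x [xF xU]]] : nbhs (g ** h ** inv h) U.
    by rewrite mulK.
  by exists i => //; exists (x ** inv h); split => //=; rewrite mulKV.
Qed.

Definition shift (h : G) (F : coherent_family) : coherent_family :=
  exist _ _ (coherent_shift h (proj2_sig F)).

Definition meets (i : address * (nat * nat)) : set coherent_family :=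
  [set F | sval F i.1 `&` V i.2 !=set0].

Definition universal_space := subbase_space meets.

Lemma coherent_family_eq (F E : coherent_family) :
  (forall n g, sval F n g <-> sval E n g) -> F = E.
Proof.
case: F E => F cF [E cE] /= FE.
have {}FE : F = E by apply/funext => n; apply/seteqP; split=> g /FE.
by case: E / FE cE => cE; congr exist; exact: Prop_irrelevance.
Qed.

(** Closed sets are recovered from the basic open sets they meet; this is why the lower Vietoris
    conditions separate points. *)
Lemma coherent_memP (F : coherent_family) n g :
  sval F n g <-> forall k, V k g -> meets (n, k) F.
Proof.
have [cF _ _ _ _] := proj2_sig F.
split=> [Fg k kg|Fg]; first by exists g.
apply: cF => A /V_base[k kg kA]; have [x [xF kx]] := Fg k kg.
by exists x; split=> //; exact: kA.
Qed.

Lemma meets_T0 F E : (forall i, meets i F <-> meets i E) -> F = E.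
Proof.
move=> FE; apply: coherent_family_eq => n g.
by split=> /coherent_memP h; apply/coherent_memP => k /h/FE.
Qed.

(** Refinement gives a point [a] of [F ((false, i) :: n)] in [V k]. Take [p] around [a] inside [V k]
    with all quotients of its points in [V i.1]: no coherent family has both its [(false, i)] and
    [(true, i)] sets meeting [V p], while the cover clause at [a] gives the other half of
    separation. *)
Lemma meets_regular F i : meets i F ->
  exists m l, meets m F /\ separates meets m l i.
Proof.
case: i => n k [g [/= Fg kg]].
have [cF F0 Fcover Fdisj Frefine] := proj2_sig F.
have [i i1 [a [Fa ka]]] := Frefine _ _ _ Fg (V_nbhs kg).
have [P [Q [aP aQ PQ]]] : exists P Q, [/\ nbhs a P, nbhs a Q &
    forall p q, P p -> Q q -> V i.1 (p ** inv q)].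
  by apply: div_nbhs; rewrite mulV; exact: V_nbhs.
have [p pa pPQ] := V_base (filterI (filterI aP aQ) (V_nbhs ka)).
exists ((false, i) :: n, p), ((true, i) :: n, p); split; first by exists a.
split=> E; have [cE E0 Ecover Edisj Erefine] := proj2_sig E.
  move=> [[x [/= Ex /pPQ[[_ Qx] _]]] [y [/= Ey /pPQ[[Py _] _]]]].
  by apply: (Edisj n i (y ** inv x) x) => //; [exact: PQ|rewrite mulKV].
have [En|En] := Ecover n i a; last by right; exists a.
by left; exists a; split=> //; have [] := pPQ a pa.
Qed.

Definition disjunction_index : Type :=
  (((address * (nat * nat)) * nat) + (address * ((nat * nat) * (nat * nat)) * (nat * nat))
   + (nat * nat) + (address * (nat * nat)))%type.

(** In order: a set meeting [V i.2] meets a small basic set well inside it; the cover clause; the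
    root is all of [G]; the refinement clause. Disjointness has no entry, since it is inherited from
    the sequence. *)
Definition disjunction (k : disjunction_index) : set (address * (nat * nat)) :=
  match k with
  | inl (inl (inl (i, q))) =>
      [set j | j.1 = i.1 /\ small q j.2 /\ closure (V j.2) `<=` V i.2]
  | inl (inl (inr (n, i, p))) =>
      [set j | j.2 = p /\ (j.1 = n \/ j.1 = (true, i) :: n)]
  | inl (inr p) => [set ([::], p)]
  | inr (n, p) =>
      [set j | j.2 = p /\ exists2 i, V i.1 one & j.1 = (false, i) :: n]
  end.

Lemma prime_set_point (P : set (address * (nat * nat))) (u : nat -> coherent_family) :
  (forall i, P i -> \forall n \near \oo, meets i (u n)) ->
  (forall i j, meets i `<=` meets j -> P i -> P j) ->
  (forall k, setT `<=` \bigcup_(i in disjunction k) meets i ->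
    exists2 i, disjunction k i & P i) ->
  (forall k j, P j -> meets j `<=` \bigcup_(i in disjunction k) meets i ->
    exists2 i, disjunction k i & P i) ->
  exists F, forall i, meets i F -> P i.
Proof.
move=> Pu Pup PT PJ.
have PV n k k' : V k `<=` V k' -> P (n, k) -> P (n, k').
  by move=> kk'; apply: Pup => F [x [Fx /kk' kx]]; exists x.
pose F n := [set g | forall k, V k g -> P (n, k)].
have P_nonempty n k : P (n, k) -> V k !=set0.
  by move=> /Pu/filter_ex[m [x [_ kx]]]; exists x.
have F_meets n k : P (n, k) -> F n `&` V k !=set0.
  move=> Pk.
  (* Primality for the first family of disjunctions lets [V k] shrink within [P] to arbitrarily
     small sets, whose limit point lies in [F n]. *)
  have shrink q (i : {k | P (n, k)}) : exists j : {k | P (n, k)},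
      small q (sval j) /\ closure (V (sval j)) `<=` V (sval i).
    case: i => i Pi /=.
    have [|[n' j] /= [-> [sj ji]] Pj] := PJ (inl (inl (inl ((n, i), q)))) _ Pi.
      move=> E [x [/= Ex ix]]; have [_ h _ _] := baseV.
      have [j [jx sj ji]] := h q _ _ (V_open i) ix.
      by exists (n, j) => //; exists x.
    by exists (exist _ j Pj).
  have [next nextP] := choice (fun qi => shrink qi.1 qi.2).
  pose s := fix s q := if q is q'.+1 then next (q', s q') else exist _ k Pk.
  have s_sub q : V (sval (s q.+1)) `<=` V (sval (s q)).
    by apply: subset_trans (@subset_closure _ _) (proj2 (nextP (q, s q))).
  have [_ _ _ h] := baseV; have [||//|x [xs sx]] := h (fun q => sval (s q)).
  - by move=> q; exact: P_nonempty (proj2_sig (s q)).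
  - by move=> q; exact: (proj1 (nextP (q, s q))).
  (* The limit is only in the closures, so stage 1 is used: its closure lies in [V k]. *)
  exists x; split; last by apply: (proj2 (nextP (0%N, s 0%N))); exact: xs 1%N.
  move=> k' k'x; have [q sk'] := sx _ (V_open k') k'x.
  exact: PV sk' (proj2_sig (s q)).
suff cF : coherent F.
  by exists (exist _ F cF) => -[n k] [x [/= Fx kx]]; exact: Fx.
split.
- move=> n g gF k kg; have [x [xF kx]] := gF _ (V_nbhs kg).
  exact: xF.
- apply/seteqP; split=> // g _ k kg.
  have [|_ -> //] := PT (inl (inr k)).
  move=> E _; exists ([::], k) => //; exists g; split=> //=.
  by have [_ -> _ _ _] := proj2_sig E.
- move=> n i g; apply: contrapT => /not_orP[].
  move=> /existsNP[k1 /not_implyP[k1g nP1]] /existsNP[k2 /not_implyP[k2g nP2]].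
  have [p pg pk] := V_base (filterI (V_nbhs k1g) (V_nbhs k2g)).
  have [|[n' p'] /= [-> [->|->]] Pp] := PT (inl (inl (inr (n, i, p)))).
  + move=> E _; have [_ _ /(_ n i g) + _ _] := proj2_sig E.
    move=> [Eg|Eg]; [exists (n, p)|exists ((true, i) :: n, p)].
    * by split=> //; left.
    * by exists g.
    * by split=> //; right.
    * by exists g.
  + by apply: nP1; apply: PV Pp => x /pk[].
  + by apply: nP2; apply: PV Pp => x /pk[].
- move=> n i v g iv Fg Fvg.
  (* Some term [u m] meets both neighbourhoods at once, at points whose quotient is still in the
     open set [V i.1], contradicting its own disjointness clause. *)
  have [Q [Q' [vgQ gQ' QQ']]] : exists Q Q', [/\ nbhs (v ** g) Q, nbhs g Q' &
      forall p q, Q p -> Q' q -> V i.1 (p ** inv q)].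
    by apply: div_nbhs; rewrite mulK; exact: V_nbhs.
  have [k kg kQ'] := V_base gQ'; have [k' k'g k'Q] := V_base vgQ.
  have [m [[x [/= Ex /kQ' kx]] [y [/= Ey /k'Q k'y]]]] :=
    filter_ex (filterI (Pu _ (Fg _ kg)) (Pu _ (Fvg _ k'g))).
  have [_ _ _ /(_ n i (y ** inv x) x) + _] := proj2_sig (u m).
  by rewrite mulKV; apply=> //; exact: QQ'.
- move=> n g U Fg /V_base[k kg kU].
  have [|[n' k'] /= [-> [i i1 ->]] Pk] := PJ (inr (n, k)) _ (Fg _ kg).
    move=> E [x [/= Ex kx]]; have [_ _ _ _ h] := proj2_sig E.
    have [i i1 [y [Ey ky]]] := h _ _ _ Ex (V_nbhs kx).
    by exists ((false, i) :: n, k); [split=> //; exists i|exists y].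
  exists i => //; have [x [Fx /kU kx]] := F_meets _ _ Pk.
  by exists x.
Qed.

Lemma universal_space_polish : polish universal_space.
Proof.
apply: (subbase_polish meets_T0 meets_regular (K := disjunction_index)).
by move=> u P; exact: prime_set_point.
Qed.

Lemma shift_action : @continuous_action G universal_space mul one shift.
Proof.
split.
- by move=> F; apply: coherent_family_eq => n g /=; rewrite mul1.
- by move=> g h F; apply: coherent_family_eq => n x /=; rewrite mulA.
- move=> [h F]; apply: cvg_subbase => -[n k] [g [/= Fg kg]].
  (* A point of [E n] in [P], translated by the inverse of any [h'] in [Q], lands in [V k]. *)
  have [P [Q [gP hQ PQ]]] : exists P Q, [/\ nbhs (g ** h) P, nbhs h Q &
      forall p q, P p -> Q q -> V k (p ** inv q)].
    by apply: div_nbhs; rewrite mulK; exact: V_nbhs.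
  have [p pg pP] := V_base gP.
  exists (Q, meets (n, p)) => /=.
    split=> //; apply: open_nbhs_nbhs; split; first exact: open_subbase.
    by exists (g ** h).
  move=> [h' E] /= [Qh' [x [/= Ex /pP Px]]].
  by exists (x ** inv h'); split=> /=; [rewrite mulKV|exact: PQ].
Qed.

(** * Encoding the points of a given [G]-space *)

Section embedding.
Variables (Y : topologicalType) (b : G -> Y -> Y).
Hypothesis actY : continuous_action mul one b.
Variables (B : nat * nat -> set Y) (smallY : nat -> nat * nat -> Prop).
Hypothesis baseB : complete_base B smallY.

Let b1 y : b one y = y. Proof. by have [] := actY. Qed.

Let bM g h y : b (g ** h) y = b g (b h y). Proof. by have [] := actY. Qed.

Let b_nbhs g y A : nbhs (b g y) A ->
  exists P Q, [/\ nbhs g P, nbhs y Q & forall p q, P p -> Q q -> A (b p q)].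
Proof. by have [_ _ bC] := actY; exact: continuous2_nbhs. Qed.

Let B_open k : open (B k). Proof. by have [] := baseB. Qed.

Definition sweep (U : set G) (A : set Y) : set Y :=
  [set z | exists g y, [/\ U g, A y & z = b g y]].

(** Either [B i.2] or empty, according to whether the thickened closure fits in [A]; thus every
    address is admissible. *)
Definition refine (i : (nat * nat) * (nat * nat)) (A : set Y) : set Y :=
  [set y | B i.2 y /\ closure (sweep (V i.1) (B i.2)) `<=` A].

Fixpoint tree_open (n : address) : set Y :=
  match n with
  | [::] => setT
  | (c, i) :: n => if c then ~` closure (sweep (V i.1) (refine i (tree_open n)))
                   else refine i (tree_open n)
  end.

(** Continuity of the action at [(one, y)] fits a product of basic sets into a basic set whose
    closure lies in [A]. *)
Lemma refine_exists A y : open A -> A y ->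
  exists2 i, V i.1 one & refine i A y.
Proof.
move=> oA Ay; have [_ hB _ _] := baseB.
have [j0 [j0y _ j0A]] := hB 0%N A y oA Ay.
have /b_nbhs[P [Q [oneP yQ PQ]]] : nbhs (b one y) (B j0).
  by rewrite b1; exact: open_nbhs_nbhs.
move: oneP yQ; rewrite !nbhsE => -[U [oU U1] UP] [W [oW Wy] WQ].
have [_ hV _ _] := baseV.
have [k [k1 _ kU]] := hV 0%N U one oU U1; have [j [jy _ jW]] := hB 0%N W y oW Wy.
exists (k, j) => //; split=> //.
apply: subset_trans j0A; apply: closureS => _ [g [z [gk zj ->]]].
apply: PQ; first by apply: UP; apply: kU; exact: subset_closure.
by apply: WQ; apply: jW; exact: subset_closure.
Qed.

Lemma refine_cover i A y : A y \/ (~` closure (sweep (V i.1) (refine i A))) y.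
Proof.
have [cl|] := pselect (closure (sweep (V i.1) (refine i A)) y); [left|by right].
(* A nonempty closure forces [refine i A] to be nonempty, which yields the inclusion in [A]. *)
have [z [[g [x [Vg [Bx clA] _]]] _]] := cl _ (@filterT _ (nbhs y) _).
apply: clA; apply: closureS cl => _ [h [w [Vh [Bw _] ->]]].
by exists h, w.
Qed.

Lemma open_tree_open n : open (tree_open n).
Proof.
elim: n => [|[c i] n IH] /=; first exact: openT.
case: c; first exact/closed_openC/closed_closure.
have [ci|nci] := pselect (closure (sweep (V i.1) (B i.2)) `<=` tree_open n).
  by rewrite (_ : refine _ _ = B i.2)//; apply/seteqP; split=> [y []|y].
rewrite (_ : refine _ _ = set0); first exact: open0.
by rewrite -subset0 => y [].
Qed.

Definition hitting (y : Y) (n : address) : set G := [set g | tree_open n (b g y)].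

Lemma hitting_coherent y : coherent (fun n => closure (hitting y n)).
Proof.
split.
- by move=> n; exact: closed_closure.
- by apply/seteqP; split=> // g _; exact: subset_closure.
- move=> n i g; rewrite -[_ \/ _]/((closure _ `|` closure _) g) -closureU.
  by apply: subset_closure; exact: refine_cover.
- move=> n i v g iv gF vgF.
  (* Approximate [g] by [x] and [v ** g] by [z] with quotient in [V i.1]: then [b z y] lies in the
     sweep whose closure it should avoid. *)
  have [P [Q [vgP gQ PQ]]] : exists P Q, [/\ nbhs (v ** g) P, nbhs g Q &
      forall p q, P p -> Q q -> V i.1 (p ** inv q)].
    by apply: div_nbhs; rewrite mulK; exact: V_nbhs.
  have [x [xF Qx]] := gF _ gQ; have [z [zF Pz]] := vgF _ vgP.
  apply: zF; apply: subset_closure; exists (z ** inv x), (b x y).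
  by split=> //; [exact: PQ|rewrite -bM mulKV].
- move=> n g U gF gU; move: gU; rewrite nbhsE => -[W [oW Wg] WU].
  have [x [xn Wx]] := nbhs_meets gF oW Wg.
  have [i i1 xi] := refine_exists (open_tree_open n) xn.
  by exists i => //; exists x; split; [exact: subset_closure|exact: WU].
Qed.

Definition embedding (y : Y) : universal_space := exist _ _ (hitting_coherent y).

Lemma embedding_continuous : continuous embedding.
Proof.
move=> y; apply: cvg_subbase => -[n k] [g [/= gF kg]].
have [x [xn kx]] := nbhs_meets gF (V_open k) kg.
have : nbhs (b x y) (tree_open n).
  by apply: open_nbhs_nbhs; split=> //; exact: open_tree_open.
move=> /b_nbhs[P [Q [xP yQ PQ]]]; apply: filterS yQ => z Qz.
exists x; split=> //; apply: subset_closure; apply: PQ => //.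
exact: nbhs_singleton.
Qed.

Lemma embedding_shift h y : embedding (b h y) = shift h (embedding y).
Proof.
apply: coherent_family_eq => n g /=; split=> gF A gA.
  have [x [xF xA]] := gF _ (nbhs_mulr gA).
  by exists (x ** h); split=> //; rewrite /hitting/= bM.
have : nbhs (g ** h ** inv h) A by rewrite mulK.
move=> /nbhs_mulr/gF[x [xF xA]]; exists (x ** inv h); split=> //.
by rewrite /hitting/= -bM mulKV.
Qed.

(** Membership of [one] in the closure of a hitting set does not put the point in the open set, so a
    second refinement is used. With [y] in the [(false, j)] child of [n] and [z] outside
    [tree_open n], hence in the [(true, j)] child, equal codes would violate disjointness for [y] at
    [one]. *)
Lemma embedding_inj : injective embedding.
Proof.
move=> y z yz; apply: contrapT => neq_yz.
have [_ _ sepB _] := baseB; have [A [oA Ay nAz]] := sepB _ _ neq_yz.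
have [i i1 [iy iA]] := refine_exists oA Ay.
pose n : address := [:: (false, i)].
have ny : tree_open n y by [].
have nz : ~ tree_open n z.
  move=> [iz _]; apply: nAz; apply: iA; apply: subset_closure.
  by exists one, z.
have [j j1 jy] := refine_exists (open_tree_open n) ny.
have [_ _ _ disj _] := hitting_coherent y.
have one_memb c w : tree_open c w -> sval (embedding w) c one.
  by move=> cw; apply: subset_closure; rewrite /hitting/= b1.
apply: (disj n j one one j1); first exact: (one_memb ((false, j) :: n)).
rewrite mul1 -[closure _ _]/(sval (embedding y) ((true, j) :: n) one) yz.
by apply: one_memb; have [] := refine_cover j (tree_open n) z.
Qed.

End embedding.

End universal_space.

Theorem theorem0p3 (G : topologicalType) (mul : G -> G -> G) (one : G) (inv : G -> G) :
  polish_group mul one inv ->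
  exists (X : topologicalType) (a : G -> X -> X),
    polish_G_space mul one a /\
    forall (Y : topologicalType) (b : G -> Y -> Y),
      polish_G_space mul one b ->
      exists pi : Y -> X,
        continuous pi /\ injective pi /\
        (forall (g : G) (y : Y), pi (b g y) = a g (pi y)).
Proof.
move=> [groupG /polish_complete_base[V [small baseV]]].
exists (universal_space mul one V), (shift groupG (V := V)); split.
  split; first exact: (universal_space_polish groupG baseV).
  exact: (shift_action groupG baseV).
move=> Y b [/polish_complete_base[B [smallY baseB]] actY].
exists (embedding groupG baseV actY baseB); split; last split.
- exact: embedding_continuous.
- exact: embedding_inj.
- by move=> g y; exact: embedding_shift.
Qed.
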